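(* Let $R$ be a finite Frobenius ring with generating character $\chi$, let $V=R^n$, and let $G$ be a finite permutation group acting on the coordinates of $V$. Let $H$ be a subgroup of $G$ such that $|H|$ has an inverse in $R$. If $C$ is a left $G$-code of length $n$ over $R$, then $$\mathbf{cwe}_H\bigl(((C^{\perp})\theta_H)M_H : \{x_a\}_{a\in R}\bigr) = \frac{1}{|C\theta_H|}\,\mathbf{cwe}_H\Bigl(C\theta_H : \Bigl\{\sum_{b\in R}\chi(ab)\,x_b\Bigr\}_{a\in R}\Bigr),$$ where $M_H$ is the $H$-orbit length matrix.
   Context: A finite (associative, unital) ring $R$ is Frobenius if $R/\mathrm{Rad}(R)\cong \mathrm{Soc}(R_R)$ as right $R$-modules and $R/\mathrm{Rad}(R)\cong\mathrm{Soc}({}_RR)$ as left $R$-modules. $R$ need not be commutative. Let $\widehat R$ be the group of homomorphisms from the additive group of $R$ to $\mathbb{C}^{*}$. A generating character of $R$ is a $\chi\in\widehat R$ that is right generating ($r\mapsto\chi^r$, $\chi^r(x)=\chi(rx)$, is an isomorphism of right $R$-modules $R\to\widehat R$) or left generating ($r\mapsto{}^r\chi$, ${}^r\chi(x)=\chi(xr)$, is an isomorphism of left $R$-modules $R\to\widehat R$); a finite ring is Frobenius if and only if it admits one. On $V=R^n$ put $(u,v):=u_1v_1+\cdots+u_nv_n$. A permutation group $G$ on $\{1,\dots,n\}$ acts on $V$ on the right by $(vg)_i = v_{ig^{-1}}$. A left $G$-code is a left $R$-submodule $C$ of $V$ with $Cg\subseteq C$ for all $g\in G$; its right dual is $C^{\perp}:=\{u\in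 V:(v,u)=0\text{ for all }v\in C\}$. ''$|H|$ has an inverse in $R$'' means $|H|\cdot 1_R$ is a unit. Define $v\theta_H:=\frac1{|H|}\sum_{h\in H}vh$ for $v\in V$ and $X\theta_H:=\{v\theta_H:v\in X\}$. Let $H_V(\alpha_1),\dots,H_V(\alpha_t)$ be the orbits of $H$ on $\{1,\dots,n\}$, $m_i$ the cardinality of $H_V(\alpha_i)$, and $\overline{H_V(\alpha_i)}\in V$ the vector with entry $1$ at the positions in $H_V(\alpha_i)$ and $0$ elsewhere. Every $u\in V\theta_H$ is uniquely $u=\sum_{i=1}^t u_i\overline{H_V(\alpha_i)}$ with $u_i\in R$. The $H$-orbit length matrix is $M_H:=\mathrm{diag}(\ell_1,\dots,\ell_n)$ with $\ell_j=m_i$ if $j\in H_V(\alpha_i)$; $YM_H:=\{yM_H:y\in Y\}$ for $Y\subseteq V$. For a left or right $R$-submodule $D\subseteq V\theta_H$, the $H$-complete weight enumerator is $\mathbf{cwe}_H(D:\{x_a\}_{a\in R}):=\sum_{u\in D}\prod_{a\in R}x_a^{n_a^H(u)}$, where $n_a^H(u)$ is the number of $i\in\{1,\dots,t\}$ with $u_i=a$. *)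

(* Defs.v *)
From HB Require Import structures.
From mathcomp Require Import all_boot all_order all_fingroup all_algebra.
From mathcomp Require Import mpoly complex reals.

Set Implicit Arguments.
Unset Strict Implicit.
Unset Printing Implicit Defensive.

Import Order.TTheory GRing.Theory Num.Theory.
Local Open Scope ring_scope.
Local Open Scope quotient_scope.

(* Without this instance, [R^c : finNzRingType] is accepted, but only by
   unfolding [R^c] to [R], which would carry the multiplication of [R]. *)
HB.instance Definition _ (R : finNzRingType) := Finite.on R^c.

Section RadicalSocle.
Variables (R : finNzRingType) (M : finLmodType R).
Implicit Types U : {set M}.

Definition submodule U : bool :=
  [&& 0 \in U, [forall x in U, forall y in U, x + y \in U] &
      [forall a : R, forall x in U, a *: x \in U]].

Lemma submoduleP U : reflect (submod_closed U) (submodule U).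
Proof.
apply: (iffP and3P) => [[U0 /forall_inP UD /forallP UZ]|[U0 UL]].
  split=> // a x y Ux Uy; apply: (forall_inP (UD _ _)) => //.
  exact: (forall_inP (UZ a)).
split=> //.
  by apply/forall_inP=> x Ux; apply/forall_inP=> y Uy; rewrite -[x]scale1r UL.
by apply/forallP=> a; apply/forall_inP=> x Ux; rewrite -[_ *: _]addr0 UL.
Qed.

Definition maximal_submodule U : bool :=
  maxset (fun W => submodule W && (W != [set: M])) U.

Definition minimal_submodule U : bool :=
  minset (fun W => submodule W && (W != [set 0])) U.

Definition radical : {pred M} :=
  [pred x | [forall U : {set M}, maximal_submodule U ==> (x \in U)]].

Lemma radical_submod_closed : submod_closed radical.
Proof.
split=> [|a x y /forallP rx /forallP ry]; apply/forallP=> U; apply/implyP=> mU.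
  by have /maxsetp/andP[/submoduleP[]] := mU.
have /maxsetp/andP[/submoduleP[_ UL] _] := mU.
by apply: UL; [exact: implyP (rx U) mU | exact: implyP (ry U) mU].
Qed.
HB.instance Definition _ :=
  GRing.isSubmodClosed.Build R M radical radical_submod_closed.

Definition module_top : Type := Quotient.quot radical.
HB.instance Definition _ := GRing.Zmodule.on module_top.

Definition top_proj (x : M) : module_top := \pi_(Quotient.quot radical) x.

Definition top_scale (a : R) (q : module_top) : module_top :=
  top_proj (a *: generic_quotient.repr (q : Quotient.quot radical)).

Lemma top_projE x y : (top_proj x == top_proj y) = (x - y \in radical).
Proof. by rewrite -Quotient.idealrBE. Qed.

Lemma top_proj_surj q : exists x, q = top_proj x.
Proof.
exists (generic_quotient.repr (q : Quotient.quot radical)).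
by rewrite /top_proj reprK.
Qed.

Lemma top_projD : {morph top_proj : x y / x + y}.
Proof. exact: raddfD. Qed.

Lemma top_scaleE a x : top_scale a (top_proj x) = top_proj (a *: x).
Proof.
apply/eqP; rewrite top_projE -scalerBr rpredZ // -top_projE.
by rewrite /top_proj reprK.
Qed.

Lemma top_scaleA a b q : top_scale a (top_scale b q) = top_scale (a * b) q.
Proof. by have [x ->] := top_proj_surj q; rewrite !top_scaleE scalerA. Qed.

Lemma top_scale1 : left_id 1 top_scale.
Proof.
by move=> q; have [x ->] := top_proj_surj q; rewrite top_scaleE scale1r.
Qed.

Lemma top_scaleDr : right_distributive top_scale +%R.
Proof.
move=> a p q; have [x ->] := top_proj_surj p; have [y ->] := top_proj_surj q.
by rewrite -top_projD !top_scaleE scalerDr top_projD.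
Qed.

Lemma top_scaleDl q : {morph top_scale^~ q : a b / a + b}.
Proof.
move=> a b; have [x ->] := top_proj_surj q.
by rewrite !top_scaleE scalerDl top_projD.
Qed.

HB.instance Definition _ := GRing.Zmodule_isLmodule.Build R module_top
  top_scaleA top_scale1 top_scaleDr top_scaleDl.

Definition socle : {set M} :=
  [set \sum_(U : {set M} | minimal_submodule U) f U
     | f : {ffun {set M} -> M}
     & [forall U, minimal_submodule U ==> (f U \in U)]].

Definition top_iso_socle : Prop :=
  exists f : {linear module_top -> M},
    injective f /\ forall y, y \in socle <-> exists q, f q = y.
End RadicalSocle.
Arguments radical {R} M _.
Arguments top_iso_socle {R} M.

(* Right R-modules are the left modules over the converse ring R^c; the radical
   of (R^c)^o is the Jacobson radical of R, see [radical_converse]. *)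
Definition frobenius (R : finNzRingType) : Prop :=
  top_iso_socle (R^c)^o /\ top_iso_socle R^o.

Lemma converse_scaleE (R : finNzRingType) (a : R^c) (b : (R^c)^o) :
  a *: b = (b : R) * (a : R) :> R.
Proof. by []. Qed.

Lemma finring_mulC1 (R : finNzRingType) (s y : R) : s * y = 1 -> y * s = 1.
Proof.
move=> sy1; have inj : injective ( *%R y) by apply: (can_inj (g := *%R s)) => a;
  rewrite mulrA sy1 mul1r.
have [g _ gK] := injF_bij inj.
have := gK 1; set t := g 1 => yt1.
by rewrite -[s in y * s]mulr1 -yt1 !mulrA -(mulrA y) sy1 mulr1.
Qed.

Lemma radicalP (R : finNzRingType) (x : R^o) :
  x \in radical R^o <-> forall r : R, exists s : R, s * (1 - r * x) = 1.
Proof.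
split=> [/forallP rx r|xP].
  pose L : {set R^o} := [set a : R^o | [exists s : R, a == s * (1 - r * x)]].
  have LP a : reflect (exists s : R, a = s * (1 - r * x)) (a \in L).
    by rewrite inE; apply: existsPP => s; apply: eqP.
  have smL : submodule L.
    apply/submoduleP; split=> [|a u v /LP[s ->] /LP[t ->]]; apply/LP.
      by exists 0; rewrite mul0r.
    by exists (a * s + t); rewrite mulrDl -mulrA.
  have [/LP[s s1]|L1] := boolP ((1 : R^o) \in L); first by exists s.
  have pL : submodule L && (L != [set: R^o]).
    by rewrite smL; apply: contraNneq L1 => ->; rewrite inE.
  have [U mU sLU] :=
    @maxset_exists _ (fun W => submodule W && (W != [set: R^o])) _ pL.
  have xU := implyP (rx U) mU.
  have /maxsetp/andP[/submoduleP[_ UL] /negP[]] := mU.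
  have U1 : (1 : R^o) \in U.
    have : (1 - r * x : R^o) \in U.
      by apply: (subsetP sLU); apply/LP; exists 1; rewrite mul1r.
    by move/(UL r _ _ xU); rewrite addrC subrK.
  have U0 : (0 : R^o) \in U by have /maxsetp/andP[/submoduleP[]] := mU.
  apply/eqP/setP=> a; rewrite inE -[a]addr0 -[a in a + 0]mulr1.
  exact: (UL a _ _ U1 U0).
apply/forallP=> U; apply/implyP=> mU; apply/negPn/negP=> xU.
have [/andP[smU nU] maxU] := maxsetP mU; have /submoduleP[U0 UL] := smU.
pose W : {set R^o} := [set a : R^o | [exists r : R, a - r * x \in U]].
have WP a : reflect (exists r : R, a - r * x \in U) (a \in W).
  by rewrite inE; apply: existsP.
have smW : submodule W.
  apply/submoduleP; split=> [|a u v /WP[s us] /WP[t vt]]; apply/WP.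
    by exists 0; rewrite mul0r subr0.
  exists (a * s + t); have := UL a _ _ us vt.
  by rewrite scalerBr addrACA -opprD mulrDl -mulrA.
have sUW : U \subset W.
  by apply/subsetP=> a Ua; apply/WP; exists 0; rewrite mul0r subr0.
have xW : x \in W by apply/WP; exists 1; rewrite mul1r subrr.
have WT : W = setT.
  apply/eqP; apply: contraT => nW; have WU := maxU W.
  by move: xU; rewrite -WU ?xW // smW nW.
have /WP[r Ur] : (1 : R^o) \in W by rewrite WT inE.
have [s s1] := xP r.
have U1 : (1 : R^o) \in U.
  have := UL s _ _ Ur U0; rewrite addr0; congr (_ \in U); exact: s1.
by case/eqP: nU; apply/setP=> a; rewrite inE -[a]mulr1 -[a * 1]addr0 (UL a).
Qed.

Lemma radical_converse (R : finNzRingType) (x : R) :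
  (x \in radical (R^c)^o) = (x \in radical R^o).
Proof.
have swap (r : R) : x * (1 - r * x) = (1 - x * r) * x.
  by rewrite mulrBr mulrBl mulr1 mul1r mulrA.
apply/idP/idP=> /radicalP xP; apply/radicalP=> r.
  have [s] := xP r; rewrite -[_ * _ = 1]/((1 - x * r) * (s : R) = 1) => xs.
  have sx := finring_mulC1 xs; exists (1 + r * (s : R) * x).
  by rewrite mulrDl mul1r -!mulrA swap (mulrA (s : R)) sx mul1r subrK.
have [s /finring_mulC1 sx] := xP r; exists (1 + x * s * r : R).
rewrite -[LHS]/((1 - x * r) * (1 + x * s * r) : R) mulrDr mulr1 !mulrA -swap.
by rewrite -(mulrA x) sx mulr1 subrK.
Qed.

Section Characters.
Variables (C : numClosedFieldType) (R : finNzRingType).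

Definition is_character (f : {ffun R -> C}) : bool :=
  [forall x, f x != 0] && [forall x, forall y, f (x + y) == f x * f y].

Record character := Character {
  character_val :> {ffun R -> C};
  characterP : is_character character_val }.
HB.instance Definition _ := [isSub for character_val].

Lemma character_neq0 (f : character) x : f x != 0.
Proof. by have /andP[/forallP/(_ x)] := characterP f. Qed.

Lemma characterD (f : character) x y : f (x + y) = f x * f y.
Proof. by have /andP[_ /forallP/(_ x)/forallP/(_ y)/eqP] := characterP f. Qed.

Lemma character_mul_proof (f g : character) :
  is_character [ffun x => f x * g x].
Proof.
apply/andP; split; apply/forallP=> x.
  by rewrite ffunE mulf_neq0 ?character_neq0.
by apply/forallP=> y; rewrite !ffunE !characterD mulrACA.
Qed.
Definition character_mul f g := Character (character_mul_proof f g).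

Lemma character_act_right_proof (f : character) (r : R) :
  is_character [ffun x => f (r * x)].
Proof.
apply/andP; split; apply/forallP=> x; first by rewrite ffunE character_neq0.
by apply/forallP=> y; rewrite !ffunE mulrDr characterD.
Qed.
(* This is f^r, the right R-module structure of the character group. *)
Definition character_act_right f r := Character (character_act_right_proof f r).

Lemma character_act_left_proof (r : R) (f : character) :
  is_character [ffun x => f (x * r)].
Proof.
apply/andP; split; apply/forallP=> x; first by rewrite ffunE character_neq0.
by apply/forallP=> y; rewrite !ffunE mulrDl characterD.
Qed.
(* This is ^r f, the left R-module structure of the character group. *)
Definition character_act_left r f := Character (character_act_left_proof r f).

Definition right_generating (chi : character) : Prop :=
  let phi r := character_act_right chi r in
  [/\ forall r s, phi (r + s) = character_mul (phi r) (phi s),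
      forall r s, phi (r * s) = character_act_right (phi r) s
    & bijective phi].

Definition left_generating (chi : character) : Prop :=
  let phi r := character_act_left r chi in
  [/\ forall r s, phi (r + s) = character_mul (phi r) (phi s),
      forall s r, phi (s * r) = character_act_left s (phi r)
    & bijective phi].

Definition generating_character (chi : character) : Prop :=
  right_generating chi \/ left_generating chi.
End Characters.

Section Codes.
Variables (R : finUnitRingType) (n : nat).
Implicit Types (u v : 'rV[R]_n) (G H : {group 'S_n}) (X C : {set 'rV[R]_n}).

Definition dotp u v : R := \sum_(i < n) u 0 i * v 0 i.

Definition perm_act v (g : 'S_n) : 'rV[R]_n := \row_i v 0 (g^-1%g i).

Definition left_code G C : Prop :=
  submodule C /\ forall g v, g \in G -> v \in C -> perm_act v g \in C.

Definition right_dual C : {set 'rV[R]_n} :=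
  [set u | [forall v in C, dotp v u == 0]].

Definition theta H v : 'rV[R]_n :=
  (#|H|%:R : R)^-1 *: \sum_(h in H) perm_act v h.

Definition theta_set H X : {set 'rV[R]_n} := [set theta H v | v in X].

Definition orbits H : {set {set 'I_n}} := orbit 'P H @: [set: 'I_n].

Definition orbit_length_mx H : 'M[R]_n :=
  diag_mx (\row_j (#|orbit 'P H j|)%:R).

Definition mulmx_set X (M : 'M[R]_n) : {set 'rV[R]_n} := [set y *m M | y in X].

Definition indicator (O : {set 'I_n}) : 'rV[R]_n := \row_j (j \in O)%:R.

(* For u in [theta_set H setT], the coefficient at O in the expansion of u over
   the indicators of the H-orbits; see [orbit_coef_sum] and [orbit_coef_unique].
   Such a u is constant on O, so the choice of j does not matter. *)
Definition orbit_coef u (O : {set 'I_n}) : R :=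
  if [pick j in O] is Some j then u 0 j else 0.

Lemma orbitsP H (O : {set 'I_n}) j : O \in orbits H -> j \in O ->
  O = orbit 'P H j.
Proof. by case/imsetP=> k _ -> jk; apply/esym/orbit_eqP. Qed.

Lemma perm_actM v g h : perm_act (perm_act v g) h = perm_act v (g * h)%g.
Proof. by apply/rowP=> j; rewrite !mxE invMg permM. Qed.

Lemma theta_orbit H v j h : h \in H -> theta H v 0 (h j) = theta H v 0 j.
Proof.
move=> Hh; rewrite !mxE !summxE; congr (_ * _).
rewrite (reindex_inj (mulIg h)) /=; apply: eq_big => [g|g _].
  by rewrite groupMr.
by rewrite !mxE invMg permM permK.
Qed.

Lemma orbit_coef_sum H u : u \in theta_set H setT ->
  u = \sum_(O in orbits H) orbit_coef u O *: indicator O.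
Proof.
case/imsetP=> v _ ->; apply/rowP=> j; rewrite summxE.
have jO : orbit 'P H j \in orbits H by apply: imset_f.
rewrite (bigD1 _ jO) /= big1 ?addr0 => [|O /andP[OH nO]]; last first.
  rewrite !mxE; have [/(orbitsP OH) eO|_] := boolP (j \in O); last first.
    by rewrite mulr0.
  by rewrite eO eqxx in nO.
rewrite [RHS]mxE [indicator _ _ _]mxE orbit_refl mulr1 /orbit_coef.
case: pickP => [k /orbitP[h Hh <-]|/(_ j)]; last by rewrite orbit_refl.
by rewrite -[in LHS](theta_orbit _ _ Hh).
Qed.

Lemma orbit_coef_unique H (c : {set 'I_n} -> R) O : O \in orbits H ->
  orbit_coef (\sum_(O' in orbits H) c O' *: indicator O') O = c O.
Proof.
move=> OH; rewrite /orbit_coef; case: pickP => [j jO|O0]; last first.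
  by case/imsetP: OH O0 => k _ -> /(_ k); rewrite orbit_refl.
rewrite summxE (bigD1 _ OH) /= big1 ?addr0 => [|O' /andP[OH' nO]].
  by rewrite !mxE jO mulr1.
rewrite !mxE; have [jO'|_] := boolP (j \in O'); last by rewrite mulr0.
by rewrite (orbitsP OH' jO') -(orbitsP OH jO) eqxx in nO.
Qed.

Definition orbit_count H u (a : R) : nat :=
  #|[set O in orbits H | orbit_coef u O == a]|.

Definition cwe (A : comNzRingType) H (D : {set 'rV[R]_n}) (x : R -> A) : A :=
  \sum_(u in D) \prod_(a : R) x a ^+ orbit_count H u a.
End Codes.

(* The indeterminate x_a, in polynomials with indeterminates indexed by R. *)
Definition cwe_var (K : nzRingType) (R : finType) (a : R) : {mpoly K[#|R|]} :=
  'X_(enum_rank a).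

(* Main.v *)
(* Averaging over H projects V onto the H-invariant vectors, i.e. those that are
   constant on the H-orbits, and is self-adjoint for the dot product. The dot
   product of two invariant vectors weights the orbit coefficients by the orbit
   lengths, which are units; M_H removes this weight, so ((C^\perp) theta_H) M_H
   is the dual of C theta_H for the unweighted product of orbit coefficients.
   The identity is then the MacWilliams identity for the submodule C theta_H of
   R^t: expand the product over orbits and use that the character sum
   \sum_v chi (v . u) over a left submodule vanishes unless u is in its dual. *)

Require Import Defs.
From HB Require Import structures.
From mathcomp Require Import all_boot all_order all_fingroup all_algebra.
From mathcomp Require Import mpoly complex reals.

Set Implicit Arguments.
Unset Strict Implicit.
Unset Printing Implicit Defensive.

Import Order.TTheory GRing.Theory Num.Theory.
Local Open Scope ring_scope.

(** * Character sums over finite modules *)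

Section Characters.
Variables (F : numClosedFieldType) (R : finNzRingType).
Implicit Types (chi : character F R) (M : finLmodType R).

Lemma character0 chi : chi 0 = 1.
Proof.
by apply: (mulfI (character_neq0 chi 0)); rewrite -characterD addr0 mulr1.
Qed.

Lemma character_sum chi (I : finType) (P : pred I) (f : I -> R) :
  chi (\sum_(i | P i) f i) = \prod_(i | P i) chi (f i).
Proof. by apply: big_morph; [exact: characterD | exact: character0]. Qed.

Lemma additive_character_sum chi (M : finZmodType) (D : {set M}) (f : M -> R) :
    {in D &, forall u v, u + v \in D} -> {in D, forall u, - u \in D} ->
    {morph f : u v / u + v} ->
  \sum_(v in D) chi (f v) =
    if [forall v in D, chi (f v) == 1] then #|D|%:R else 0.
Proof.
move=> DD DN fD; case: ifP => [/forall_inP chi1|/negbT].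
  by rewrite (eq_bigr _ (fun v Dv => eqP (chi1 v Dv))) sumr_const.
(* Translation by [w] permutes [D] and multiplies the sum by [chi (f w)], which is not 1; hence the
   sum is 0. *)
case/forall_inPn=> w Dw chi_w; apply: (mulfI (x := chi (f w) - 1)).
  by rewrite subr_eq0.
rewrite mulr0 mulrBl mul1r mulr_sumr; apply/eqP; rewrite subr_eq0; apply/eqP.
rewrite [RHS](reindex_inj (addrI w)) /=.
apply: eq_big => [v|v _]; last by rewrite fD characterD.
apply/idP/idP=> [|Dwv]; first exact: DD.
by rewrite -[v](addKr w) DD ?DN.
Qed.

Lemma ring_character_sum chi (f : R -> R) : {morph f : u v / u + v} ->
  \sum_x chi (f x) = if [forall x, chi (f x) == 1] then #|R|%:R else 0.
Proof.
move=> fD; have := @additive_character_sum chi R setT f.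
rewrite cardsT (eq_bigl _ _ (@in_setT R)) => -> //.
  by congr (if _ then _ else _); apply: eq_forallb => x; rewrite inE.
all: by move=> *; rewrite inE.
Qed.

(* For right generating chi, the double sum of chi (r * x) is #|R| when summed
   over x first, and #|R| times the number of a that are killed by chi on the
   left ideal R a when summed over r first. *)
Lemma generating_character_eq0 chi (a : R) : generating_character chi ->
  (forall r, chi (r * a) = 1) -> a = 0.
Proof.
case=> [[_ _ /bij_inj inj]|[_ _ /bij_inj inj]] chia1; last first.
  by apply: inj; apply/val_inj/ffunP=> x; rewrite !ffunE mulr0 chia1 character0.
have dbl : \sum_r \sum_x chi (r * x) = #|R|%:R :> F.
  rewrite (bigD1 0) //= [X in _ + X]big1 ?addr0 => [|r r0].
    by rewrite -sumr_const; apply: eq_bigr => x _; rewrite mul0r character0.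
  rewrite ring_character_sum => [|u v]; last by rewrite mulrDr.
  case: ifP => // /forallP chir; case/eqP: r0; apply: inj.
  by apply/val_inj/ffunP=> x; rewrite !ffunE (eqP (chir x)) mul0r character0.
move: dbl; rewrite exchange_big /=.
rewrite (eq_bigr (fun x =>
  if [forall r, chi (r * x) == 1] then #|R|%:R else 0)); last first.
  by move=> x _; apply: ring_character_sum => u v; rewrite mulrDl.
have chi0 : [forall r, chi (r * 0) == 1].
  by apply/forallP=> r; rewrite mulr0 character0.
have chia : [forall r, chi (r * a) == 1] by apply/forallP=> r; rewrite chia1.
apply: contra_eq => a0.
rewrite (bigD1 0) //= chi0 (bigD1 a) //= chia addrCA addrC -subr_eq0 addrK.
rewrite gt_eqF // ltr_wpDr ?ltr0n ?card_gt0 //; last first.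
  by apply/card_gt0P; exists 0.
by apply: sumr_ge0 => x _; case: ifP.
Qed.

(** If [chi] is trivial on [f D], it is trivial on each left ideal [R (f v)], since [D] is stable
    under scaling; a generating character then forces [f v = 0]. *)
Lemma submodule_character_sum chi M (D : {set M}) (f : M -> R^o) :
    linear f -> generating_character chi -> submodule D ->
  \sum_(v in D) chi (f v) = if [forall v in D, f v == 0] then #|D|%:R else 0.
Proof.
move=> f_lin chi_gen /submoduleP[D0 DL].
have fZ := GRing.scalable_linear f_lin.
have DZ a v : v \in D -> a *: v \in D.
  by move=> Dv; rewrite -[_ *: _]addr0 DL.
rewrite (@additive_character_sum chi M D f); last by
  move=> u v; rewrite -[u in LHS]scale1r f_lin scale1r.
- congr (if _ then _ else _); apply/forall_inP/forall_inP=> chi1 v Dv.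
    apply/eqP/(generating_character_eq0 chi_gen)=> r.
    by apply/eqP; rewrite -[r * _]/(r *: f v) -fZ chi1 ?DZ.
  by rewrite (eqP (chi1 v Dv)) character0.
- by move=> u v Du Dv; rewrite -[u]scale1r DL.
by move=> u Du; rewrite -scaleN1r DZ.
Qed.
End Characters.

(** * Orbit coefficients and the weight of the orbit lengths *)

Section Orbits.
Variables (R : finUnitRingType) (n : nat) (H : {group 'S_n}).
Implicit Types (u v : 'rV[R]_n) (X : {set 'rV[R]_n}) (O : {set 'I_n}).

Lemma orbit_coef_linear O : linear (fun u => orbit_coef u O : R^o).
Proof.
move=> a u v; rewrite /orbit_coef; case: pickP => [j _|_].
  by rewrite !mxE.
by rewrite scaler0 addr0.
Qed.

Definition orbit_dot v u : R :=
  \sum_(O in orbits H) orbit_coef v O * orbit_coef u O.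

Lemma orbit_dot_linear u : linear (fun v => orbit_dot v u : R^o).
Proof.
move=> a v w; rewrite /orbit_dot scaler_sumr -big_split.
apply: eq_bigr => O _ /=.
by rewrite orbit_coef_linear mulrDl; congr (_ + _); apply: (esym (mulrA _ _ _)).
Qed.

(** When [#|H|] is a unit, these are the vectors of [theta_set H setT], see [mem_theta_setT]. *)
Definition orbit_constant u := forall h j, h \in H -> u 0 (h j) = u 0 j.

Lemma orbit_coefE u j O : orbit_constant u -> O \in orbits H -> j \in O ->
  orbit_coef u O = u 0 j.
Proof.
move=> uH /orbitsP OH /[dup] jO /OH ->; rewrite /orbit_coef.
case: pickP => [k /orbitP[h Hh <-]|/(_ j)]; first exact: uH.
by rewrite orbit_refl.
Qed.

(** Orbits are grouped by coefficient. The product over orbits is the form that distributes over the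
    substituted sums. *)
Lemma cwe_prod_orbits (A : comNzRingType) (D : {set 'rV[R]_n}) (x : R -> A) :
  cwe H D x = \sum_(u in D) \prod_(O in orbits H) x (orbit_coef u O).
Proof.
apply: eq_bigr => u _.
rewrite (partition_big (orbit_coef u) xpredT) //=; apply: eq_bigr => a _.
rewrite (eq_bigr (fun=> x a)) => [|O /andP[_ /eqP-> //]].
rewrite prodr_const; congr (_ ^+ _).
by apply: eq_card => O; rewrite !inE.
Qed.

Lemma sum_orbits (A : nmodType) (f : 'I_n -> A) :
  \sum_j f j = \sum_(O in orbits H) \sum_(j in O) f j.
Proof.
rewrite (partition_big (orbit 'P H) (mem (orbits H))) => [|j _]; last first.
  exact: imset_f.
apply: eq_bigr => O OH; apply: eq_bigl => j /=.
apply/eqP/idP=> [<-|/(orbitsP OH) -> //]; exact: orbit_refl.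
Qed.

Lemma mulmx_orbit_length u j :
  (u *m orbit_length_mx R H) 0 j = u 0 j * #|orbit 'P H j|%:R.
Proof. by rewrite mul_mx_diag !mxE. Qed.

Lemma card_orbit_perm h j : h \in H ->
  #|orbit 'P H (h j)| = #|orbit 'P H j|.
Proof. by move=> Hh; congr #|pred_of_set _|; apply: orbit_act. Qed.

(** An orbit [O] contributes [#|O|] equal terms to the dot product, and the matrix supplies the same
    factor. *)
Lemma orbit_dot_mulmx v u : orbit_constant v -> orbit_constant u ->
  orbit_dot v (u *m orbit_length_mx R H) = dotp v u.
Proof.
move=> vH uH; rewrite /dotp sum_orbits; apply: eq_bigr => O OH.
have [j jO] : exists j, j \in O.
  by case/imsetP: OH => j _ ->; exists j; apply: orbit_refl.
have uMH : orbit_constant (u *m orbit_length_mx R H).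
  by move=> h k Hh; rewrite !mulmx_orbit_length uH ?card_orbit_perm.
rewrite (orbit_coefE vH OH jO) (orbit_coefE uMH OH jO) mulmx_orbit_length.
rewrite -(orbitsP OH jO) mulrA mulr_natr -sumr_const; apply: eq_bigr => k kO.
by rewrite -!(orbit_coefE _ OH kO) // !(orbit_coefE _ OH jO).
Qed.

(** Lets the factor [1/#|H|] move past scalars of a noncommutative [R]. No unit is required: the
    inverse of a non-unit is by convention itself. *)
Lemma comm_invnat m (a : R) : GRing.comm a (m%:R)^-1.
Proof. by apply: commrV; apply: commr_nat. Qed.

Lemma theta_linear : linear (theta H : 'rV[R]_n -> 'rV[R]_n).
Proof.
move=> a u v; rewrite /theta [in RHS]scalerA comm_invnat -scalerA -scalerDr.
rewrite [in RHS]scaler_sumr -big_split; congr (_ *: _); apply: eq_bigr => h _.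
by apply/rowP=> j; rewrite !mxE.
Qed.
HB.instance Definition _ := GRing.isLinear.Build R _ _ _ _ theta_linear.

Lemma theta_constant u : orbit_constant (theta H u).
Proof. by move=> h j Hh; apply: theta_orbit. Qed.

(** * Averaging as a self-adjoint projection *)

Section Averaging.
Hypothesis H_unit : (#|H|%:R : R) \is a GRing.unit.

(** Meant for the orbit lengths, which divide [#|H|]. Commuting factors of a unit are units. *)
Lemma natr_dvd_unit m : (m %| #|H|)%N -> (m%:R : R) \is a GRing.unit.
Proof.
case/dvdnP=> k def_H; move: H_unit; rewrite def_H natrM => kmU.
by move: kmU; rewrite unitrM_comm => [/andP[] //|]; apply: commr_nat.
Qed.

Lemma theta_fix u : orbit_constant u -> theta H u = u.
Proof.
move=> uH; rewrite /theta (eq_bigr (fun=> u)) => [|h Hh].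
  by rewrite sumr_const -scaler_nat scalerA mulVr ?scale1r.
by apply/rowP=> j; rewrite mxE uH ?groupV.
Qed.

(** The adjoint of the action of [h] is the action of its inverse, which also runs over [H]. *)
Lemma dotp_theta v u : dotp v (theta H u) = dotp (theta H v) u.
Proof.
have -> : dotp v (theta H u) =
    (#|H|%:R)^-1 * \sum_(h in H) \sum_j v 0 j * u 0 (h^-1%g j).
  rewrite exchange_big mulr_sumr; apply: eq_bigr => j _.
  rewrite !mxE summxE mulrA comm_invnat -mulrA mulr_sumr; congr (_ * _).
  by apply: eq_bigr => h _; rewrite mxE.
have -> : dotp (theta H v) u =
    (#|H|%:R)^-1 * \sum_(h in H) \sum_j v 0 (h^-1%g j) * u 0 j.
  rewrite exchange_big mulr_sumr; apply: eq_bigr => j _.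
  rewrite !mxE summxE -mulrA mulr_suml; congr (_ * _).
  by apply: eq_bigr => h _; rewrite mxE.
rewrite (reindex_inj invg_inj); congr (_ * _).
apply: eq_big => [h|h _]; first by rewrite groupV.
rewrite (reindex_inj (@perm_inj _ h^-1%g)); apply: eq_bigr => j _.
by rewrite invgK permKV.
Qed.

Lemma mem_theta_set X u : {in X, forall v, theta H v \in X} ->
  u \in theta_set H X <-> u \in X /\ orbit_constant u.
Proof.
move=> XH; split=> [/imsetP[v Xv ->]|[Xu /theta_fix <-]]; last exact: imset_f.
by split; [apply: XH | apply: theta_constant].
Qed.

Lemma mem_theta_setT u : u \in theta_set H setT <-> orbit_constant u.
Proof.
have memT : u \in theta_set H setT <-> u \in setT /\ orbit_constant u.
  by apply: mem_theta_set => v _; rewrite inE.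
by split=> [/memT[]|uH] //; apply/memT; rewrite inE.
Qed.

Lemma theta_set_submodule X : submodule X -> submodule (theta_set H X).
Proof.
move=> /submoduleP[X0 XL]; apply/submoduleP; split.
  by apply/imsetP; exists 0; rewrite ?linear0.
move=> a _ _ /imsetP[u Xu ->] /imsetP[v Xv ->].
by rewrite -linearP imset_f ?XL.
Qed.

(** Choosing one coefficient per orbit amounts to choosing a vector of [theta_set H setT]. *)
Lemma prod_sum_orbits (A : comNzRingType) (f : {set 'I_n} -> R -> A) :
  \prod_(O in orbits H) \sum_b f O b =
  \sum_(u in theta_set H setT) \prod_(O in orbits H) f O (orbit_coef u O).
Proof.
(* Choice functions are defined on all sets of positions; the default 0 off the orbits makes them
   unique. *)
rewrite (big_distr_big_dep 0).
pose vec (c : {ffun {set 'I_n} -> R}) : 'rV[R]_n :=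
  \sum_(O in orbits H) c O *: indicator R O.
pose coefs u := [ffun O => if O \in orbits H then orbit_coef u O else 0].
have vecC c : orbit_constant (vec c).
  move=> h j Hh; rewrite !summxE; apply: eq_bigr => O OH; rewrite !mxE.
  congr (_ * (_ : bool)%:R); case/imsetP: OH => k _ ->.
  by rewrite -!orbit_eq_mem; congr (_ == _); apply: orbit_act.
rewrite (reindex_onto coefs vec) => [|c /pfamilyP[/supportP c0 _]]; last first.
  apply/ffunP=> O; rewrite ffunE; case: ifP => [OH|/negbT OH].
    exact: orbit_coef_unique.
  by rewrite c0.
apply: eq_big => [u|u _]; last by apply: eq_bigr => O OH; rewrite ffunE OH.
apply/andP/idP=> [[_ /eqP <-]|uH]; first exact/mem_theta_setT.
split.
  apply/pfamilyP; split=> //; apply/supportP=> O OH.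
  by rewrite ffunE (negPf OH).
rewrite eq_sym {1}(orbit_coef_sum uH); apply/eqP/eq_bigr => O OH.
by rewrite ffunE OH.
Qed.

(** * The dual of the averaged code *)

Section Code.
Variables (G : {group 'S_n}) (C : {set 'rV[R]_n}).
Hypotheses (sHG : H \subset G) (C_code : left_code G C).

Lemma left_code_theta : {in C, forall v, theta H v \in C}.
Proof.
move=> v Cv; have [/submoduleP[C0 CL] CG] := C_code.
rewrite -[theta H v]addr0 CL //.
apply: (big_ind (fun w => w \in C)) => // [u w Cu Cw|h Hh].
  by rewrite -[u]scale1r CL.
by rewrite CG // (subsetP sHG).
Qed.

Lemma right_dual_theta :
  {in right_dual C, forall u, theta H u \in right_dual C}.
Proof.
move=> u; rewrite !inE => /forall_inP Cu; apply/forall_inP=> v Cv.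
by rewrite dotp_theta Cu ?left_code_theta.
Qed.

(* Averaging is self-adjoint for [dotp], so on H-invariant vectors duality
   against C is duality against [theta_set H C]. *)
Lemma mem_dual_theta u :
  u \in mulmx_set (theta_set H (right_dual C)) (orbit_length_mx R H) <->
  u \in theta_set H setT /\ forall v, v \in theta_set H C -> orbit_dot v u = 0.
Proof.
have memC := mem_theta_set _ left_code_theta.
have memD := mem_theta_set _ right_dual_theta.
split=> [/imsetP[w /memD[]]|[/mem_theta_setT uH Cu]].
  rewrite inE => /forall_inP Cw wH ->; split.
    apply/mem_theta_setT=> h j Hh.
    by rewrite !mulmx_orbit_length wH ?card_orbit_perm.
  by move=> v /memC[Cv vH]; rewrite orbit_dot_mulmx //; apply/eqP/Cw.
(* Dividing by the orbit lengths, which are units, inverts the orbit length matrix. *)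
pose w : 'rV[R]_n := \row_j (u 0 j * (#|orbit 'P H j|%:R)^-1).
have wH : orbit_constant w.
  by move=> h j Hh; rewrite !mxE uH ?card_orbit_perm.
have def_u : u = w *m orbit_length_mx R H.
  apply/rowP=> j; rewrite mulmx_orbit_length mxE mulrVK //.
  by apply: natr_dvd_unit; apply: dvdn_orbit.
apply/imsetP; exists w => //; apply/memD; split=> //.
rewrite inE; apply/forall_inP=> v Cv.
rewrite -(theta_fix wH) dotp_theta -orbit_dot_mulmx //;
  last exact: theta_constant.
by rewrite -def_u Cu ?imset_f.
Qed.
End Code.
End Averaging.
End Orbits.

Theorem theorem3p4 (K : realType) (R : finUnitRingType)
    (chi : character K[i] R) (n : nat) (G H : {group 'S_n})
    (C : {set 'rV[R]_n}) :
  frobenius R -> generating_character chi ->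
  H \subset G -> (#|H|%:R : R) \is a GRing.unit ->
  left_code G C ->
  cwe H (mulmx_set (theta_set H (right_dual C)) (orbit_length_mx R H))
      (fun a : R => cwe_var K[i] a)
  = (#|theta_set H C|%:R : K[i])^-1 *:
    cwe H (theta_set H C)
      (fun a : R => \sum_(b : R) chi (a * b) *: cwe_var K[i] b).
Proof.
move=> _ chi_gen sHG H_unit C_code.
set D := theta_set H C; rewrite !cwe_prod_orbits.
have smD : submodule D by apply: theta_set_submodule; case: C_code.
have D_neq0 : #|D|%:R != 0 :> K[i].
  by rewrite pnatr_eq0 -lt0n; apply/card_gt0P; exists 0; case/submoduleP: smD.
pose X u : {mpoly K[i][#|R|]} :=
  \prod_(O in orbits H) cwe_var K[i] (orbit_coef u O).
(* Since [chi] turns the sum over orbits into a product, the scalars picked up by each monomial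
   [X u] combine into one character value. *)
have expand v : \prod_(O in orbits H)
      \sum_b chi (orbit_coef v O * b) *: cwe_var K[i] b
    = \sum_(u in theta_set H setT) chi (orbit_dot H v u) *: X u.
  rewrite prod_sum_orbits //; apply: eq_bigr => u _.
  by rewrite scaler_prod character_sum.
under [in RHS]eq_bigr do rewrite expand.
rewrite exchange_big scaler_sumr /=.
(* The coefficient of [X u] is now a character sum over the submodule [D], divided by [#|D|]: it is
   1 if [u] is orthogonal to [D] for [orbit_dot], and 0 otherwise. *)
under [RHS]eq_bigr => u _.
  rewrite -scaler_suml (submodule_character_sum (orbit_dot_linear H u)) //.
  rewrite scalerA.
  over.
rewrite [RHS](bigID (fun u => [forall v in D, orbit_dot H v u == 0])) /=.
rewrite [X in _ + X]big1 ?addr0 => [|u /andP[_ /negPf->]]; last first.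
  by rewrite mulr0 scale0r.
apply: eq_big => [u|u].
  apply/idP/andP=> [|[? /forall_inP Du]].
    case/(mem_dual_theta H_unit sHG C_code)=> ? Du.
    by split=> //; apply/forall_inP=> v Dv; rewrite Du.
  by apply/(mem_dual_theta H_unit sHG C_code); split=> // v Dv; apply/eqP/Du.
case/(mem_dual_theta H_unit sHG C_code)=> _ Du.
case: forall_inP => [_|[]]; first by rewrite mulVf ?scale1r.
by move=> v Dv; rewrite Du.
Qed.
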